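(* There exists a constant $c>0$ such that for any integers $3\le k\le n$ and any $\delta\in(0,1/e]$: (i) (fixed design) $$\sup_{\lambda\in\mathbb R}\ \inf_{0\le t_1<\cdots<t_n\le1}\mathsf Q_{1-\delta}\Big(\Gamma_{V_{n,k}(t_1,\dots,t_n)}(\varepsilon;\lambda\mathbf 1_n)\Big)\ge c\Big(k\log\frac{en}{k}+\log\frac1\delta\Big),$$ where $\varepsilon\sim p_{\lambda\mathbf 1_n}$; (ii) (random design) for any probability measure $P$ on $[0,1]$ such that i.i.d. $T_1,\dots,T_n\sim P$ are almost surely distinct, $$\sup_{\lambda\in\mathbb R}\mathsf Q_{1-\delta}\Big(\Gamma_{V_{n,k}(T_1,\dots,T_n)}(\varepsilon;\lambda\mathbf 1_n)\Big)\ge c\Big(k\log\frac{en}{k}+\log\frac1\delta\Big),$$ where the quantile is over both $T_{1:n}$ and $\varepsilon$, with $\varepsilon\mid T_{1:n}\sim p_{\lambda\mathbf 1_n}$; (iii) for any probability measure $P$ on $[0,1]$ such that i.i.d. $T_1,\dots,T_n\sim P$ are almost surely distinct, $$\mathbf E_{T_1,\dots,T_n\sim P}\,\mathbf E_\varepsilon\,\Gamma_{V_{n,k}(T_1,\dots,T_n)}(\varepsilon;v_{n,k})\ \ge\ \inf_{0\le t_1<\cdots<t_n\le1}\mathbf E_\varepsilon\,\Gamma_{V_{n,k}(t_1,\dots,t_n)}(\varepsilon;v_{n,k})\ \ge\ c\,k\log\frac{en}{k},$$ where $\varepsilon\sim p_{v_{n,k}}$ (independently of $T_{1:n}$).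
   Context: $\sigma(t)=1/(1+e^{-t})$, and $\mathbf 1_n\in\mathbb R^n$ is the all-ones vector. For $v\in\mathbb R^n$ and $\varepsilon\in\{-1,1\}^n$, $p_v(\varepsilon)=\prod_{i=1}^n\sigma(\varepsilon_iv_i)$, a probability mass function on $\{-1,1\}^n$. For a subspace $W\subset\mathbb R^n$, $\Gamma_W(\varepsilon;v)=\sup_{w\in W}\log\frac{p_w(\varepsilon)}{p_v(\varepsilon)}$. For a real random variable $Z$, $\mathsf Q_{1-\delta}(Z)=\inf\{z\in\mathbb R:\mathbf P(Z\le z)\ge1-\delta\}$. For $t_1,\dots,t_n\in[0,1]$ the Vandermonde subspace is $$V_{n,k}(t_1,\dots,t_n)=\{(p(t_1),\dots,p(t_n)):p\in\mathbb R[t],\ \deg p\le k-1\}\subset\mathbb R^n.$$ For $3\le k\le n$, $$v_{n,k}=\sigma^{-1}\Big(1-\frac1n\Big\lfloor\frac{k-1}{2}\Big\rfloor\Big)\mathbf 1_n.$$ *)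

(* Defs.v *)
From HB Require Import structures.
From mathcomp Require Import all_boot all_order all_algebra.
From mathcomp Require Import all_classical all_reals all_analysis.
From mathcomp Require Import ring.

Set Implicit Arguments.
Unset Strict Implicit.
Unset Printing Implicit Defensive.

Import Order.TTheory GRing.Theory Num.Theory.
Import numFieldNormedType.Exports.

Local Open Scope classical_set_scope.
Local Open Scope ring_scope.

Definition sigmoid {R : realType} (t : R) : R := 1 / (1 + expR (- t)).

(* The inverse of [sigmoid] as a bijection from R onto ]0, 1[; see [sigmoidK]
   and [logitK]. *)
Definition logit {R : realType} (x : R) : R := ln (x / (1 - x)).

Section sigmoid_theory.
Context {R : realType}.

Lemma sigmoid_gt0 (t : R) : 0 < sigmoid t.
Proof. by rewrite divr_gt0// addr_gt0// expR_gt0. Qed.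

Lemma sigmoidN (t : R) : sigmoid (- t) = 1 - sigmoid t.
Proof.
rewrite /sigmoid opprK expRN; have := expR_gt0 t; set y := expR t => y0.
have : 1 + y != 0 by rewrite gt_eqF// addr_gt0.
have : y != 0 by rewrite gt_eqF.
by move=> ? ?; field; rewrite ?(addrC _ 1); do ?[apply/andP; split].
Qed.

Lemma sigmoid_lt1 (t : R) : sigmoid t < 1.
Proof. by rewrite -subr_gt0 -sigmoidN sigmoid_gt0. Qed.

Lemma sigmoidK : cancel (@sigmoid R) logit.
Proof.
move=> t; rewrite /logit -sigmoidN.
suff -> : sigmoid t / sigmoid (- t) = expR t by rewrite expRK.
rewrite /sigmoid opprK expRN; have := expR_gt0 t; set y := expR t => y0.
have : 1 + y != 0 by rewrite gt_eqF// addr_gt0.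
have : y != 0 by rewrite gt_eqF.
by move=> ? ?; field; rewrite ?(addrC _ 1); do ?[apply/andP; split].
Qed.

Lemma logitK : {in `]0, 1[, cancel logit (@sigmoid R)}.
Proof.
move=> x; rewrite in_itv/= => /andP[x0 x1].
have x1' : 0 < 1 - x by rewrite subr_gt0.
rewrite /sigmoid /logit expRN lnK ?posrE ?divr_gt0//.
have : 1 - x != 0 by rewrite gt_eqF.
have : x != 0 by rewrite gt_eqF.
move=> xN0 x1N0; rewrite invf_div (_ : 1 + _ = x^-1) ?div1r ?invrK//.
by field.
Qed.

End sigmoid_theory.

(* A sign vector is encoded by n booleans, [b] standing for the sign (-1) ^+ b
   (true is -1, false is +1). *)
Definition sgn {R : realType} {n : nat} (e : n.-tuple bool) (i : 'I_n) : R :=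
  (-1) ^+ tnth e i.

Definition pmf_sign {R : realType} {n : nat} (v : 'rV[R]_n)
  (e : n.-tuple bool) : R := \prod_(i < n) sigmoid (sgn e i * v 0 i).

Definition sign_prob {R : realType} {n : nat} (v : 'rV[R]_n) :
  set (n.-tuple bool) -> \bar R := fun A => (\sum_(e \in A) (pmf_sign v e)%:E)%E.

Section sign_prob_probability.
Context {R : realType} {n : nat} (v : 'rV[R]_n).

Lemma pmf_sign_gt0 e : 0 < pmf_sign v e.
Proof. by apply: prodr_gt0 => i _; exact: sigmoid_gt0. Qed.

Lemma pmf_sign_le1 e : pmf_sign v e <= 1.
Proof.
by apply: prodr_ile1 => i _; rewrite ltW ?sigmoid_gt0// ltW// sigmoid_lt1.
Qed.

Lemma sum_pmf_sign : \sum_e pmf_sign v e = 1.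
Proof.
pose F (i : 'I_n) (b : bool) : R := sigmoid ((-1) ^+ b * v 0 i).
transitivity (\sum_(f : {ffun 'I_n -> bool}) \prod_i F i (f i)).
  rewrite (reindex (fun f : {ffun 'I_n -> bool} => [tuple f i | i < n])) /=.
    apply: eq_bigr => f _; apply: eq_bigr => i _.
    by rewrite /sgn tnth_mktuple.
  exists (fun e : n.-tuple bool => [ffun i => tnth e i]) => [f|e] _.
    by apply/ffunP => i; rewrite ffunE tnth_mktuple.
  by apply: eq_from_tnth => i; rewrite tnth_mktuple ffunE.
rewrite -bigA_distr_bigA big1//= => i _.
by rewrite big_bool/= /F/= expr1 expr0 mulN1r mul1r sigmoidN addrC subrKC.
Qed.

Let sign_prob0 : sign_prob v set0 = 0%E.
Proof. by rewrite /sign_prob fsbig_set0. Qed.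

Let sign_prob_ge0 U : (0 <= sign_prob v U)%E.
Proof.
rewrite /sign_prob fsbig_finite//= sumEFin lee_fin.
by apply: sumr_ge0 => /= e _; rewrite ltW// pmf_sign_gt0.
Qed.

Let sign_prob_sigma_additive : semi_sigma_additive (sign_prob v).
Proof.
have pge0 e : (0 <= (pmf_sign v e)%:E)%E by rewrite lee_fin ltW// pmf_sign_gt0.
move=> F mF tF mUF; rewrite /sign_prob; apply: cvg_toP.
  apply: ereal_nondecreasing_is_cvgn => m k mk.
  by apply: lee_sum_nneg_natr => // j _ _; exact: sign_prob_ge0.
transitivity (\sum_(0 <= i <oo) (\esum_(j in F i) (pmf_sign v j)%:E))%E.
  by apply: eq_eseriesr => k _; rewrite esum_fset//; exact: finite_finset.
rewrite -nneseries_sum_bigcup//=.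
by rewrite esum_fset//; exact: finite_finset.
Qed.

HB.instance Definition _ := isMeasure.Build _ _ _ (sign_prob v)
  sign_prob0 sign_prob_ge0 sign_prob_sigma_additive.

Let sign_prob_setT : sign_prob v [set: _] = 1%E.
Proof.
rewrite /sign_prob (_ : [set: _] = [set` index_enum (n.-tuple bool : finType)]).
  by rewrite -fsbig_seq ?index_enum_uniq// sumEFin sum_pmf_sign.
by apply/seteqP; split=> // e _ /=; rewrite mem_index_enum.
Qed.

HB.instance Definition _ :=
  @Measure_isProbability.Build _ _ R (sign_prob v) sign_prob_setT.

End sign_prob_probability.

(* Gamma_W(e; v); the supremum is finite for nonempty W, see [has_sup_Gamma]. *)
Definition Gamma {R : realType} {n : nat} (W : set 'rV[R]_n)
    (e : n.-tuple bool) (v : 'rV[R]_n) : R :=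
  sup [set ln (pmf_sign w e / pmf_sign v e) | w in W].

Lemma has_sup_Gamma {R : realType} {n : nat} (W : set 'rV[R]_n)
    (e : n.-tuple bool) (v : 'rV[R]_n) :
  W !=set0 -> has_sup [set ln (pmf_sign w e / pmf_sign v e) | w in W].
Proof.
move=> [w Ww]; split; first by exists (ln (pmf_sign w e / pmf_sign v e)); exists w.
exists (ln (1 / pmf_sign v e)) => _ [u _ <-].
rewrite ler_ln ?posrE ?divr_gt0 ?pmf_sign_gt0//.
by rewrite ler_pM2r ?invr_gt0 ?pmf_sign_gt0// pmf_sign_le1.
Qed.

(* deg p <= k - 1 is [size p <= k]; this includes the zero polynomial. *)
Definition vandermonde {R : realType} (n k : nat) (t : n.-tuple R) :
    set 'rV[R]_n :=
  [set \row_(i < n) p.[tnth t i] | p in [set p : {poly R} | (size p <= k)%N]].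

Definition ones {R : realType} {n : nat} : 'rV[R]_n := const_mx 1.

Definition vnk {R : realType} (n k : nat) : 'rV[R]_n :=
  logit (1 - (k.-1 %/ 2)%:R / n%:R) *: ones.

Definition fixed_design {R : realType} (n : nat) : set (n.-tuple R) :=
  [set t | (forall i, 0 <= tnth t i <= 1) /\
           (forall i j : 'I_n, (i < j)%N -> tnth t i < tnth t j)].

Definition quantile {d} {T : measurableType d} {R : realType}
    (mu : probability T R) (q : R) (Z : T -> R) : \bar R :=
  ereal_inf [set z%:E | z in [set z : R | (q%:E <= mu [set x | (Z x <= z)%R])%E]].

Section iid.
Context {d} {T : measurableType d}.

Definition cons_pair n (x : T * n.-tuple T) : n.+1.-tuple T :=
  [tuple of x.1 :: x.2].

Lemma measurable_cons_pair n : measurable_fun [set: T * n.-tuple T] (@cons_pair n).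
Proof. exact: measurable_cons. Qed.

HB.instance Definition _ n :=
  isMeasurableFun.Build _ _ _ _ (@cons_pair n) (@measurable_cons_pair n).

End iid.

(* The joint law of n i.i.d. variables of law P, i.e. the n-fold product
   measure; see [iid_lawE]. *)
Fixpoint iid_law {d} {T : measurableType d} {R : realType}
    (P : probability T R) (n : nat) : probability (n.-tuple T) R :=
  match n return probability (n.-tuple T) R with
  | 0 => \d_([tuple] : 0.-tuple T)
  | m.+1 => distribution (P \x iid_law P m)%E (@cons_pair _ T m)
  end.

Lemma iid_lawE {d} {T : measurableType d} {R : realType}
    (P : probability T R) (n : nat) (A : 'I_n -> set T) :
  (forall i, measurable (A i)) ->
  iid_law P n [set t | forall i, A i (tnth t i)] = (\prod_(i < n) P (A i))%E.
Proof.
elim: n A => [|n IH] A mA.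
  rewrite big_ord0 /= diracE mem_set//; by case.
rewrite big_ord_recl -IH//.
have mB : measurable [set t : n.-tuple T | forall i, A (lift ord0 i) (tnth t i)].
  rewrite (_ : [set _ | _] = \big[setI/setT]_(i < n)
      ((fun t : n.-tuple T => tnth t i) @^-1` A (lift ord0 i))).
    apply: bigsetI_measurable => i _.
    by rewrite -[X in measurable X]setTI; exact: measurable_tnth.
  rewrite -bigcap_seq; apply/seteqP; split=> t /= At i; first by move=> _; exact: At.
  by apply: At; rewrite /= mem_index_enum.
have mA0 := mA ord0.
rewrite -product_measure1E//= /distribution/pushforward; congr (_ _).
apply/seteqP; split=> -[x t] /=.
  move=> At; split; first by have := At ord0; rewrite tnth0.
  by move=> i; have := At (lift ord0 i); rewrite tnthS.
move=> [Ax At] i; case: (unliftP ord0 i) => [j|] ->; last by rewrite tnth0.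
by rewrite tnthS.
Qed.

(* Main.v *)
(* With m = floor((k - 1) / 2), a polynomial of degree 2m <= k - 1 can be made
   negative at any m given design points and positive at the others; scaling it
   up drives the fitted likelihood to 1. Hence a sign vector with N <= m minus
   signs satisfies Gamma >= log (1 / p_v), which is at least N log (1 / q) when
   v is constant and q is the probability of a minus sign; N is binomial.

   For the quantiles, let q = m / (2n) when m >= 16, where Chebyshev's
   inequality gives m/4 <= N <= 3m/4 with probability at least 1/2, and q = 1/n
   otherwise, where N = 1 has probability (1 - 1/n)^(n-1) > 1/e. The term
   log (1 / delta) comes from the all-plus vector, with q such that its
   probability is the square root of delta.

   For the expectation, q = m / n. For large m, a fourth-moment argument shows
   that m/2 <= N <= m has probability bounded below; for bounded m the event
   N = 1 suffices. In the random design the expectation given the design is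
   invariant under permutations of the points, so the points may be sorted. *)

Require Import Defs.
From mathcomp Require Import all_boot all_order all_algebra fingroup perm.
From mathcomp Require Import all_classical all_reals all_analysis.
From mathcomp Require Import measurable_realfun ring lra zify.

Import Order.TTheory GRing.Theory Num.Theory.
Import numFieldNormedType.Exports.

Local Open Scope classical_set_scope.
Local Open Scope ring_scope.

(** * Binomial means and moments *)

(* The mean of [f] under the binomial law with parameters [n] and [q]. *)
Fixpoint bin_mean {R : realType} (q : R) (n : nat) (f : nat -> R) : R :=
  match n with
  | 0 => f 0%N
  | m.+1 => q * bin_mean q m (fun j => f j.+1) + (1 - q) * bin_mean q m f
  end.

Lemma eq_bin_mean {R : realType} (q : R) (n : nat) (f g : nat -> R) :
  f =1 g -> bin_mean q n f = bin_mean q n g.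
Proof. by move=> /funext ->. Qed.

Lemma le_bin_mean {R : realType} (q : R) (n : nat) (f g : nat -> R) :
  0 < q < 1 -> (forall j, f j <= g j) -> bin_mean q n f <= bin_mean q n g.
Proof.
move=> /[dup] q01 /andP[q0 q1]; elim: n f g => [|n IH] f g fg /=; first exact: fg.
apply: lerD; apply: ler_wpM2l; rewrite ?subr_ge0 ?(ltW q0) ?(ltW q1)//; exact: IH.
Qed.

Lemma bin_mean_cst {R : realType} (q : R) (n : nat) (a : R) :
  bin_mean q n (fun=> a) = a.
Proof. by elim: n => //= n ->; ring. Qed.

Lemma bin_mean_eq0 {R : realType} (q : R) (n : nat) (a : R) :
  bin_mean q n (fun j => a * (j == 0)%:R) = a * (1 - q) ^+ n.
Proof.
have z m : bin_mean q m (fun j => a * (j.+1 == 0%N)%:R) = 0.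
  by rewrite (eq_bin_mean _ _ _ (fun=> 0)) ?bin_mean_cst// => j; rewrite mulr0.
by elim: n => /= [|n IH]; rewrite ?mulr1// z IH exprS; ring.
Qed.

Lemma bin_mean_eq1 {R : realType} (q : R) (n : nat) (a : R) :
  bin_mean q n.+1 (fun j => a * (j == 1)%:R) = a * (n.+1%:R * q * (1 - q) ^+ n).
Proof.
elim: n => [|n IH]; first by rewrite /=; ring.
transitivity (q * bin_mean q n.+1 (fun j => a * (j == 0)%:R) +
  (1 - q) * bin_mean q n.+1 (fun j => a * (j == 1)%:R)) => //.
by rewrite IH bin_mean_eq0 -[n.+2%:R]natr1 exprS; ring.
Qed.

(* With [s] the variance, this encodes the first four centred moments at once, a
   form in which the induction on [n] goes through. *)
Lemma bin_mean_quartic {R : realType} (q : R) (n : nat) (a b c d e : R) :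
  let s := n%:R * q * (1 - q) in
  bin_mean q n (fun j => let x := j%:R - n%:R * q in
    a * x ^+ 4 + b * x ^+ 3 + c * x ^+ 2 + d * x + e) =
  a * (3 * s ^+ 2 + s * (1 - 6 * q * (1 - q))) + b * (s * (1 - 2 * q)) + c * s + e.
Proof.
elim: n a b c d e => [|n IH] a b c d e /=; first by rewrite !mul0r; ring.
pose F x := a * x ^+ 4 + b * x ^+ 3 + c * x ^+ 2 + d * x + e.
(* One more trial shifts the centred count by [1 - q] or by [- q], so the induction hypothesis is
   needed for the quartic [F] translated by [y]. Its linear coefficient must be supplied by hand, as
   the first centred moment vanishes. *)
have sum y : bin_mean q n (fun j => F (j%:R - n%:R * q + y)) =
  let s := n%:R * q * (1 - q) in
  a * (3 * s ^+ 2 + s * (1 - 6 * q * (1 - q)))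
  + (4 * a * y + b) * (s * (1 - 2 * q)) + (6 * a * y ^+ 2 + 3 * b * y + c) * s + F y.
  rewrite /= -(IH _ _ _ (4 * a * y ^+ 3 + 3 * b * y ^+ 2 + 2 * c * y + d)).
  by apply: eq_bin_mean => j /=; rewrite /F; ring.
transitivity (q * bin_mean q n (fun j => F (j%:R - n%:R * q + (1 - q))) +
    (1 - q) * bin_mean q n (fun j => F (j%:R - n%:R * q + - q))).
  by congr (_ * _ + _ * _); apply: eq_bin_mean => j;
    rewrite /F -[n.+1%:R]natr1 -?[j.+1%:R]natr1; ring.
by rewrite !sum /= /F -[n.+1%:R]natr1; ring.
Qed.

(** * The number of minus signs as a binomial variable *)

Lemma sum_tuple_cons {R : realType} {n : nat} (F : n.+1.-tuple bool -> R) :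
  \sum_e F e = \sum_(e : n.-tuple bool) F [tuple of true :: e] +
               \sum_(e : n.-tuple bool) F [tuple of false :: e].
Proof.
rewrite (reindex (fun be : bool * n.-tuple bool => [tuple of be.1 :: be.2])) /=; last first.
  exists (fun e : n.+1.-tuple bool => (thead e, [tuple of behead e])) => [[b e]|e] _.
    by congr pair; apply: val_inj.
  by rewrite -tuple_eta.
by rewrite -(pair_bigA _ (fun b (e : n.-tuple bool) => F [tuple of b :: e])) /= big_bool.
Qed.

Lemma sum_bin_mean {R : realType} {n : nat} (q : R) (f : nat -> R) :
  \sum_(e : n.-tuple bool)
     (\prod_(i < n) (if tnth e i then q else 1 - q)) * f (count id e) =
  bin_mean q n f.
Proof.
elim: n f => [|n IH] f.
  rewrite (big_pred1 [tuple]) => [|e]; last by apply/esym/eqP; exact: tuple0.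
  by rewrite big_ord0 mul1r.
rewrite sum_tuple_cons /= -!IH !mulr_sumr; congr (_ + _); apply: eq_bigr => e _;
  rewrite big_ord_recl tnth0 mulrA ?add0n; congr (_ * _ * _);
  by apply: eq_bigr => i _; rewrite tnthS.
Qed.

(** With the parameter [logit (1 - q)], [q] is the probability of a minus sign, that is of [true],
    so [count id] is the number of successes. *)
Lemma pmf_sign_const {R : realType} {n : nat} (q : R) (e : n.-tuple bool) :
  0 < q < 1 ->
  pmf_sign (logit (1 - q) *: ones) e =
  \prod_(i < n) (if tnth e i then q else 1 - q).
Proof.
move=> /andP[q0 q1]; apply: eq_bigr => i _; rewrite !mxE mulr1 /sgn.
have L : sigmoid (logit (1 - q)) = 1 - q.
  by rewrite logitK// in_itv/= subr_gt0 q1 ltrBlDr ltrDl.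
by case: (tnth e i); rewrite ?expr1 ?expr0 ?mulN1r ?mul1r ?sigmoidN L// subKr.
Qed.

Lemma mean_sign_count {R : realType} {n : nat} (q : R) (f : nat -> R) :
  0 < q < 1 ->
  \sum_(e : n.-tuple bool) pmf_sign (logit (1 - q) *: ones) e * f (count id e) =
  bin_mean q n f.
Proof.
move=> q01; rewrite -sum_bin_mean; apply: eq_bigr => e _.
by rewrite pmf_sign_const.
Qed.

Lemma pmf_sign_count {R : realType} {n : nat} (q : R) (e : n.-tuple bool) :
  0 < q < 1 ->
  pmf_sign (logit (1 - q) *: ones) e =
  q ^+ count id e * (1 - q) ^+ (n - count id e).
Proof.
move=> q01; rewrite pmf_sign_const//.
elim: n e => [|n IH] e.
  by rewrite big_ord0 tuple0 /= mulr1.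
case/tupleP: e => b e; rewrite big_ord_recl tnth0.
under eq_bigr => i _ do rewrite tnthS.
rewrite IH /=; case: b; first by rewrite add1n subSS exprS mulrA.
have := count_size id e; rewrite size_tuple add0n => ce.
by rewrite subSn// exprS; ring.
Qed.

(** * Lower bounds on [Gamma] by polynomial separation *)

(** Constant polynomials are available since [0 < k], so [w = v] competes in the supremum and
    contributes [ln 1]. *)
Lemma Gamma_const_ge0 {R : realType} {n k : nat} (t : n.-tuple R)
    (e : n.-tuple bool) (lambda : R) :
  (0 < k)%N -> 0 <= Gamma (vandermonde k t) e (lambda *: ones).
Proof.
move=> k0; have Wl : vandermonde k t (lambda *: ones).
  exists lambda%:P; first exact: leq_trans (size_polyC_leq1 _) k0.
  by apply/rowP => i; rewrite !mxE hornerC mulr1.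
have nW : vandermonde k t !=set0 by exists (lambda *: ones).
apply: (sup_upper_bound (has_sup_Gamma e (lambda *: ones) nW)).
by exists (lambda *: ones); rewrite // divff ?ln1// gt_eqF// pmf_sign_gt0.
Qed.

(** Twice [1 + u <= exp u]: first 1 + exp(-x) <= exp(exp(-x)), then exp(x) >= 1 + x >= y bounds the
    inner exponential by 1/y. *)
Lemma expR_le_sigmoid {R : realType} (x y : R) :
  0 < y <= x -> expR (- y^-1) <= sigmoid x.
Proof.
move=> /andP[y0 yx]; have e0 := expR_gt0 (- x).
rewrite /sigmoid div1r (expRN y^-1) lef_pV2 ?posrE ?expR_gt0 ?addr_gt0//.
apply: (le_trans (expR_ge1Dx _)); rewrite ler_expR expRN lef_pV2 ?posrE ?expR_gt0//.
by apply: (le_trans yx); apply: le_trans (expR_ge1Dx x); rewrite lerDr.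
Qed.

(* The square of the monic polynomial vanishing exactly at the minus signs,
   shifted slightly downwards, has the sign pattern [e] at the points [t]. *)
Lemma separating_poly {R : realType} {n k : nat} (t : n.-tuple R)
    (e : n.-tuple bool) :
  uniq t -> ((count id e).*2 < k)%N ->
  exists2 p : {poly R}, (size p <= k)%N &
  exists2 eta : R, 0 < eta & forall i, eta <= sgn e i * p.[tnth t i].
Proof.
move=> ut ek.
pose s := [seq tnth t i | i <- enum 'I_n & tnth e i].
pose r : {poly R} := \prod_(x <- s) ('X - x%:P).
have ss : size s = count id e.
  by rewrite size_map size_filter -[in RHS](map_tnth_enum e) count_map.
have sr : size r = (count id e).+1 by rewrite size_prod_XsubC ss.
have inj_t : injective (tnth t) by exact/tuple_uniqP.
have rE i : (r.[tnth t i] == 0) = tnth e i.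
  by rewrite -[_ == 0]/(root r _) root_prod_XsubC (mem_map inj_t) mem_filter mem_enum andbT.
(* The default 1 keeps [eta] positive when there is no plus sign. Shifting by half of it leaves the
   margin [eta / 2] at both kinds of points. *)
pose eta := \big[Num.min/1]_(i < n | ~~ tnth e i) r.[tnth t i] ^+ 2.
have eta0 : 0 < eta.
  by apply: lt_bigmin => // i ei; rewrite exprn_even_gt0//= rE.
have eta2 : 0 < eta / 2 by rewrite divr_gt0.
exists (r ^+ 2 - (eta / 2)%:P).
  apply: leq_trans ek; apply: (leq_trans (size_polyD _ _)).
  rewrite geq_max size_polyN (leq_trans (size_polyC_leq1 _))// andbT.
  by rewrite expr2 (leq_trans (size_polyMleq _ _))// sr addSn addnS addnn.
exists (eta / 2) => // i; rewrite !hornerE /sgn.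
case: (boolP (tnth e i)) => ei.
  have /eqP -> : r.[tnth t i] == 0 by rewrite rE.
  by rewrite expr0n/= sub0r expr1 mulN1r opprK.
rewrite expr0 mul1r lerBrDr -splitr.
exact: bigmin_le_cond.
Qed.

(** Likelihood 1 is only approached, hence the slack [eps]. Scaling the separating polynomial by
    [y / eta] makes every signed value at least [y = n.+1 / eps], and the [n] factors lose at most n
    / y <= eps in the logarithm. *)
Lemma Gamma_ge_separated {R : realType} {n k : nat} (t : n.-tuple R)
    (e : n.-tuple bool) (v : 'rV[R]_n) :
  uniq t -> ((count id e).*2 < k)%N ->
  ln (1 / pmf_sign v e) <= Gamma (vandermonde k t) e v.
Proof.
move=> ut ek; have [p pk [eta eta0 etap]] := separating_poly t e ut ek.
apply/ler_addgt0Pr => eps eps0.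
pose y := n.+1%:R / eps.
have y0 : 0 < y by rewrite divr_gt0.
pose w : 'rV[R]_n := \row_i ((y / eta) *: p).[tnth t i].
have Ww : vandermonde k t w.
  by exists ((y / eta) *: p) => //=; exact: leq_trans (size_scale_leq _ _) pk.
have nW : vandermonde k t !=set0 by exists w.
have v0 := pmf_sign_gt0 v e; have w0 := pmf_sign_gt0 w e.
have le_w : expR (- eps) <= pmf_sign w e.
  apply: (@le_trans _ _ (\prod_(i < n) expR (- y^-1))).
    rewrite prodr_const card_ord -expRM_natl ler_expR mulrN lerN2 /y invf_div.
    rewrite mulrA ler_pdivrMr// mulrC ler_wpM2l ?ler_nat//; exact: ltW.
  apply: ler_prod => i _; rewrite expR_ge0 /= expR_le_sigmoid// y0 /= !mxE hornerZ.
  rewrite [leRHS](_ : _ = y / eta * (sgn e i * p.[tnth t i])); last by ring.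
  by rewrite -mulrA ler_peMr ?(ltW y0)// mulrC ler_pdivlMr// mul1r.
have : ln (pmf_sign w e / pmf_sign v e) <= Gamma (vandermonde k t) e v.
  by apply: (sup_upper_bound (has_sup_Gamma e v nW)); exists w.
rewrite -lerBlDr; apply: le_trans.
rewrite !ln_div ?posrE// ln1 sub0r [leLHS]addrC lerD2r.
by rewrite -[leLHS]expRK ler_ln ?posrE ?expR_gt0.
Qed.

(** * Permutation of the design points *)

Definition permute {T : Type} {n : nat} (s : 'S_n) (t : n.-tuple T) :
  n.-tuple T := [tuple tnth t (s i) | i < n].

(** Permuting points and signs together only reorders the factors of each likelihood, and a constant
    parameter is unchanged. *)
Lemma Gamma_const_permute {R : realType} {n : nat} (k : nat) (s : 'S_n)
    (t : n.-tuple R) (e : n.-tuple bool) (lambda : R) :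
  Gamma (vandermonde k (permute s t)) (permute s e) (lambda *: ones) =
  Gamma (vandermonde k t) e (lambda *: ones).
Proof.
have pm (f : R -> R) : \prod_(i < n) sigmoid (sgn (permute s e) i * f (tnth (permute s t) i)) =
   \prod_(i < n) sigmoid (sgn e i * f (tnth t i)).
  rewrite [RHS](reindex_inj (@perm_inj _ s)); apply: eq_bigr => i _.
  by rewrite /sgn !tnth_mktuple.
have pv : pmf_sign (lambda *: ones) (permute s e) = pmf_sign (lambda *: ones) e.
  by rewrite /pmf_sign; under eq_bigr do rewrite mxE mxE;
     under [RHS]eq_bigr do rewrite mxE mxE; exact: (pm (fun=> lambda * 1)).
have pw (p : {poly R}) : pmf_sign (\row_i p.[tnth (permute s t) i]) (permute s e) =
    pmf_sign (\row_i p.[tnth t i]) e.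
  rewrite /pmf_sign; under eq_bigr do rewrite mxE.
  by under [RHS]eq_bigr do rewrite mxE; exact: (pm (horner p)).
rewrite /Gamma pv; congr sup; apply/seteqP; split=> _ /= [_ [p pk <-] <-].
  by exists (\row_i p.[tnth t i]); [exists p|rewrite pw].
by exists (\row_i p.[tnth (permute s t) i]); [exists p|rewrite pw].
Qed.

(** The sign law with constant parameter is exchangeable, so a permutation of the points is absorbed
    by reindexing the signs. *)
Lemma mean_Gamma_permute {R : realType} {n : nat} (k : nat) (s : 'S_n)
    (t : n.-tuple R) (q : R) :
  0 < q < 1 ->
  let v := logit (1 - q) *: ones in
  \sum_e pmf_sign v e * Gamma (vandermonde k (permute s t)) e v =
  \sum_e pmf_sign v e * Gamma (vandermonde k t) e v.
Proof.
move=> q01 /=; rewrite (reindex (permute s)); last first.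
  exists (permute s^-1%g) => e _; apply: eq_from_tnth => i.
    by rewrite !tnth_mktuple permKV.
  by rewrite !tnth_mktuple permK.
apply: eq_bigr => e _; rewrite Gamma_const_permute !pmf_sign_const//.
congr (_ * _); rewrite [RHS](reindex_inj (@perm_inj _ s)).
by apply: eq_bigr => i _; rewrite tnth_mktuple.
Qed.

Lemma uniq_permute_increasing {R : realType} {n : nat} (t : n.-tuple R) :
  uniq t -> exists s : 'S_n,
    forall i j : 'I_n, (i < j)%N -> tnth (permute s t) i < tnth (permute s t) j.
Proof.
move=> ut; have /tuple_permP[s st] : perm_eq (sort <=%R t) t by rewrite perm_sort.
exists s => i j ij; have := ut; rewrite -sort_lt_sorted st => sorted_st.
by rewrite !(tnth_nth 0) (sorted_ltn_nth lt_trans) ?inE ?size_tuple.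
Qed.

Lemma fixed_design_uniq {R : realType} {n : nat} (t : n.-tuple R) :
  fixed_design t -> uniq t.
Proof.
move=> [_ incr_t]; apply/tuple_uniqP => i j tij.
by case: (ltngtP i j) => [/incr_t|/incr_t|/val_inj//]; rewrite tij ltxx.
Qed.

(** * Integrals and quantiles under the sign law and the random design *)

(** The integral of a nonnegative function is a supremum over the simple functions below it, and a
    larger function has more of them. This serves to integrate over the design without studying the
    measurability of [Gamma]. *)
Lemma le_integral_nonmeasurable d (T : measurableType d) (R : realType)
    (mu : {measure set T -> \bar R}) (f g : T -> \bar R) :
  (forall x, 0 <= f x)%E -> (forall x, f x <= g x)%E ->
  (\int[mu]_x f x <= \int[mu]_x g x)%E.
Proof.
move=> f0 fg; rewrite !ge0_integralTE// => [|x]; last exact: le_trans (fg x).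
apply: ge_ereal_sup => _ [h hf <-]; apply: ereal_sup_ubound.
by exists h => // x; exact: le_trans (fg x).
Qed.

Lemma measurable_sign {n : nat} (A : set (n.-tuple bool)) : measurable A.
Proof.
have m1 (e : n.-tuple bool) : measurable [set e].
  rewrite (_ : [set e] = \big[setI/setT]_(i < n)
      ((fun x : n.-tuple bool => tnth x i) @^-1` [set tnth e i])).
    apply: bigsetI_measurable => i _.
    by rewrite -[X in measurable X]setTI; exact: measurable_tnth.
  rewrite -bigcap_seq; apply/seteqP; split=> x /=; first by move=> ->.
  by move=> xe; apply: eq_from_tnth => i; apply: xe; rewrite /= mem_index_enum.
rewrite (_ : A = \bigcup_(e in A) [set e]); last by rewrite bigcup_imset1 image_id.
by apply: fin_bigcup_measurable.
Qed.

Lemma sign_prob1 {R : realType} {n : nat} (v : 'rV[R]_n) (e : n.-tuple bool) :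
  sign_prob v [set e] = (pmf_sign v e)%:E.
Proof. by rewrite /sign_prob fsbig_set1. Qed.

Lemma integral_sign_prob {R : realType} {n : nat} (v : 'rV[R]_n)
    (f : n.-tuple bool -> R) : (forall e, 0 <= f e) ->
  (\int[sign_prob v]_e (f e)%:E = (\sum_e pmf_sign v e * f e)%:E)%E.
Proof.
move=> f0.
have fE (x : n.-tuple bool) :
    ((f x)%:E = \sum_e (f e)%:E * (\1_[set e] x)%:E)%E.
  rewrite (bigD1 x)//= big1 => [|e ex]; first by rewrite indicE mem_set// mule1 adde0.
  by rewrite indicE memNset ?mule0// => /= xe; rewrite xe eqxx in ex.
under eq_integral => x _ do rewrite fE.
rewrite ge0_integral_sum//=; last 2 first.
- by move=> e _ Y _; exact: measurable_sign.
- by move=> e x _; rewrite mule_ge0// lee_fin.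
rewrite -sumEFin; apply: eq_bigr => e _.
rewrite ge0_integralZl_EFin//=; last by move=> _ Y _; exact: measurable_sign.
rewrite integral_indic//; last exact: measurable_sign.
by rewrite setIT mulrC EFinM; congr (_ * _)%E; exact: sign_prob1.
Qed.

Lemma sign_prob_pred {R : realType} {n : nat} (v : 'rV[R]_n)
    (b : pred (n.-tuple bool)) :
  sign_prob v [set e | b e] = (\sum_e pmf_sign v e * (b e)%:R)%:E.
Proof.
transitivity (\int[sign_prob v]_e (\1_[set e | b e] e)%:E)%E.
  by rewrite integral_indic ?setIT//; exact: measurable_sign.
rewrite -integral_sign_prob//=; apply: eq_integral => e _; rewrite indicE.
by congr (_%:R%:E); congr nat_of_bool; apply/idP/idP; rewrite inE.
Qed.

Lemma sign_prob_sublevel {R : realType} {n : nat} (v : 'rV[R]_n)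
    (b : pred (n.-tuple bool)) (Z : n.-tuple bool -> R) (z z' : R) :
  (forall e, b e -> z <= Z e) -> z' < z ->
  (sign_prob v [set e | (Z e <= z')%R] <= (1 - \sum_e pmf_sign v e * (b e)%:R)%:E)%E.
Proof.
move=> bZ z'z.
rewrite EFinB -sign_prob_pred -probability_setC; last exact: measurable_sign.
apply: le_measure; rewrite ?inE; try exact: measurable_sign.
by move=> e /= Zz' /bZ /(le_trans)/(_ Zz'); rewrite leNgt z'z.
Qed.

(** A level below [z] has a sublevel set avoiding [b], of mass less than [1 - delta], and so is not
    admissible in the infimum. *)
Lemma quantile_sign_ge {R : realType} {n : nat} (v : 'rV[R]_n)
    (b : pred (n.-tuple bool)) (Z : n.-tuple bool -> R) (z delta : R) :
  delta < \sum_e pmf_sign v e * (b e)%:R -> (forall e, b e -> z <= Z e) ->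
  (z%:E <= quantile (sign_prob v) (1 - delta) Z)%E.
Proof.
move=> db bZ; apply: le_ereal_inf_tmp => _ [z' /= qz' <-]; rewrite lee_fin leNgt.
apply/negP => /(sign_prob_sublevel v b Z _ _ bZ) /(le_trans qz').
by rewrite lee_fin lerD2l lerN2 leNgt db.
Qed.

(* The sublevel sets of [Z] need not be measurable, but the product measure of a
   set is the integral of the measures of its sections, which is monotone on
   arbitrary nonnegative functions. *)
Lemma quantile_random_ge {R : realType} {d} {T : measurableType d} {n : nat}
    (Q : probability T R) (D : set T) (v : 'rV[R]_n) (b : pred (n.-tuple bool))
    (Z : T * n.-tuple bool -> R) (z delta : R) :
  {ae Q, forall t, D t} ->
  delta < \sum_e pmf_sign v e * (b e)%:R ->
  (forall t e, D t -> b e -> z <= Z (t, e)) ->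
  (z%:E <= quantile (Q \x sign_prob v)%E (1 - delta) Z)%E.
Proof.
move=> [N [mN N0 DN]] db bZ.
apply: le_ereal_inf_tmp => _ [z' /= qz' <-]; rewrite lee_fin leNgt.
apply/negP => z'z; set S := \sum_e _ in db.
have S1 : 0 <= 1 - S.
  by rewrite -lee_fin EFinB -sign_prob_pred -probability_setC//; exact: measurable_sign.
suff : ((Q \x sign_prob v)%E [set te | (Z te <= z')%R] <= (1 - S)%:E)%E.
  by move=> /(le_trans qz'); rewrite lee_fin lerD2l lerN2 leNgt db.
(* Sections over [D] have mass at most [1 - S] and all others at most 1; the indicator of the null
   set [N] pays for the latter and integrates to 0. *)
apply: (@le_trans _ _ (\int[Q]_t ((1 - S)%:E + (\1_N t)%:E))%E).
  apply: le_integral_nonmeasurable => t /=; first exact: measure_ge0.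
  have xs : xsection [set te | (Z te <= z')%R] t = [set e | Z (t, e) <= z'].
    by apply/seteqP; split=> e; rewrite xsectionE /= ?inE.
  rewrite xs; have [Dt|nDt] := pselect (D t).
    apply: (@le_trans _ _ (1 - S)%:E); last by rewrite leeDl// lee_fin.
    by apply: (sign_prob_sublevel v b _ z) => // e; exact: bZ.
  rewrite indicE mem_set; last exact: DN.
  apply: (@le_trans _ _ 1%E); last by rewrite leeDr// lee_fin.
  by apply: probability_le1; exact: measurable_sign.
rewrite ge0_integralD//=; last by apply/measurable_EFinP; exact: measurable_indic.
rewrite integral_indic// setIT [X in (_ + X)%E]N0 adde0 integral_cst//.
by rewrite [X in (_ * X)%E](@probability_setT _ _ _ Q) mule1.
Qed.

Lemma expectation_Gamma {R : realType} {n k : nat} (t : n.-tuple R) (lambda : R) :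
  (0 < k)%N -> let v := lambda *: ones in
  'E_(sign_prob v)[fun e => Gamma (vandermonde k t) e v]%E =
  (\sum_e pmf_sign v e * Gamma (vandermonde k t) e v)%:E.
Proof.
move=> k0 /=; rewrite expectation.unlock integral_sign_prob// => e.
exact: Gamma_const_ge0.
Qed.

Lemma iid_law_ae {d} {T : measurableType d} {R : realType}
    (P : probability T R) (n : nat) (A : set T) :
  measurable A -> P A = 1%E -> {ae iid_law P n, forall t, forall i, A (tnth t i)}.
Proof.
move=> mA PA; pose E := [set t : n.-tuple T | forall i, A (tnth t i)].
have mE : measurable E.
  rewrite (_ : E = \big[setI/setT]_(i < n)
      ((fun t : n.-tuple T => tnth t i) @^-1` A)).
    apply: bigsetI_measurable => i _.
    by rewrite -[X in measurable X]setTI; exact: measurable_tnth.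
  rewrite -bigcap_seq; apply/seteqP; split=> t /= Et i; first by move=> _; exact: Et.
  by apply: Et; rewrite /= mem_index_enum.
exists (~` E); split; [exact: measurableC| |by []].
rewrite probability_setC// [X in (_ - X)%E](iid_lawE P (fun=> mA)).
by rewrite big1// subee.
Qed.

(** The function equal to [c] off the null set [N] and to 0 on it is a measurable minorant of [f],
    with integral [c]. *)
Lemma ge_integral_ae {d} {T : measurableType d} {R : realType}
    (Q : probability T R) (D : set T) (f : T -> \bar R) (c : \bar R) :
  {ae Q, forall t, D t} -> (0 <= c)%E -> (forall t, 0 <= f t)%E ->
  (forall t, D t -> c <= f t)%E -> (c <= \int[Q]_t f t)%E.
Proof.
move=> [N [mN N0 DN]] c0 f0 cf.
apply: (@le_trans _ _ (\int[Q]_(t in ~` N) cst c t)%E).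
  have QN : Q (~` N) = 1%E by rewrite probability_setC// [X in (1 - X)%E]N0 sube0.
  rewrite integral_cst; last exact: measurableC.
  by rewrite [X in (_ * X)%E]QN mule1.
rewrite integral_mkcond; apply: le_integral_nonmeasurable => t.
  exact: erestrict_ge0.
rewrite patchE; case: ifPn => [|_]; last exact: f0.
rewrite inE /= => Nt; apply: cf.
by apply: contra_notP Nt => nDt; exact: DN.
Qed.

Lemma inf_fixed_le_random {R : realType} (n k : nat) (q : R)
    (P : probability (measurableTypeR R) R) :
  (0 < k)%N -> 0 < q < 1 ->
  P `[0, 1]%classic = 1%E ->
  {ae iid_law P n, forall t : n.-tuple (measurableTypeR R), uniq (t : seq R)} ->
  let v := logit (1 - q) *: ones in
  (ereal_inf [set
     'E_(sign_prob v)[fun e => Gamma (vandermonde k t) e v]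
     | t in @fixed_design R n]
   <= \int[iid_law P n]_t
     'E_(sign_prob v)[fun e => Gamma (vandermonde k t) e v])%E.
Proof.
move=> k0 q01 P01 aeu /=; set v := logit (1 - q) *: ones.
have E0 (t : n.-tuple R) :
    (0 <= 'E_(sign_prob v)[fun e => Gamma (vandermonde k t) e v])%E.
  rewrite expectation_Gamma// lee_fin sumr_ge0// => e _.
  by rewrite mulr_ge0 ?Gamma_const_ge0// ltW// pmf_sign_gt0.
have ae01 : {ae iid_law P n, forall t, forall i, `[0, 1]%classic (tnth t i)}.
  by apply: iid_law_ae => //; exact: measurable_itv.
pose D := [set t : n.-tuple (measurableTypeR R) |
  uniq (t : seq R) /\ forall i, `[0, 1]%classic (tnth t i : R)].
apply: (ge_integral_ae _ D) => //.
- by apply: filterS2 aeu ae01 => t; split.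
- by apply: le_ereal_inf_tmp => _ [t _ <-].
move=> t [ut t01]; have [s st] := uniq_permute_increasing t ut.
rewrite expectation_Gamma// -(mean_Gamma_permute k s t q q01).
rewrite -expectation_Gamma//; apply: ereal_inf_lbound; exists (permute s t) => //.
split=> // i; rewrite tnth_mktuple.
by have := t01 (s i); rewrite /= in_itv.
Qed.

(** * Elementary bounds on e and on k log(en/k) *)

(** The upper bound follows from exp(-1/6) >= 5/6 and (6/5)^6 < 3. *)
Lemma expR1_bounds {R : realType} : 2 < expR (1 : R) <= 3.
Proof.
apply/andP; split; first by have := @expR_gt1Dx R 1 (oner_neq0 _).
have h : 5 / 6 <= expR (- (1 / 6)) :> R.
  by apply: le_trans (expR_ge1Dx _); lra.
rewrite expRN in h; have e0 := expR_gt0 (1 / 6 : R).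
have e6 : expR (1 / 6) <= 6 / 5 :> R.
  by rewrite -[leLHS]invrK invf_ple ?posrE ?invr_gt0//; apply: le_trans h; lra.
rewrite [X in expR X](_ : 1 = 6%:R * (1 / 6) :> R); last by field.
rewrite expRM_natl; apply: (@le_trans _ _ ((6 / 5) ^+ 6)).
  by rewrite lerXn2r// nnegrE ltW.
by lra.
Qed.

Lemma half_degree_bounds (k : nat) : (3 <= k)%N ->
  let m := (k.-1 %/ 2)%N in [/\ (0 < m)%N, (m.*2 < k)%N & (k <= m.*2.+2)%N].
Proof. by move=> k3; split; lia. Qed.

(** Serves to pass from [k] to the half degree m = floor((k - 1) / 2), for which k <= 2m + 2 <=
    4m. *)
Lemma k_log_le {R : realType} (n k m : nat) (X : R) :
  (0 < k <= 4 * m)%N -> (k <= n)%N -> 1 <= X -> expR 1 * n%:R / k%:R <= X ->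
  k%:R * ln (expR 1 * n%:R / k%:R) <= 4 * m%:R * ln X.
Proof.
move=> /andP[k0 km] kn X1 le_X; have n0 : (0 < n)%N := leq_trans k0 kn.
apply: ler_pM => //.
- apply: ln_ge0; rewrite ler_pdivlMr ?ltr0n// mul1r.
  have /andP[e2 _] := @expR1_bounds R.
  by apply: (@le_trans _ _ n%:R); rewrite ?ler_nat// ler_peMl ?ler0n//; lra.
- by rewrite -natrM ler_nat.
- rewrite ler_ln ?posrE//; last exact: lt_le_trans X1.
  by rewrite divr_gt0 ?mulr_gt0 ?expR_gt0 ?ltr0n.
Qed.

Lemma k_log_ge0 {R : realType} (n k : nat) :
  (0 < k <= n)%N -> 0 <= k%:R * ln (expR 1 * n%:R / k%:R) :> R.
Proof.
move=> /andP[k0 kn]; rewrite mulr_ge0// ln_ge0// ler_pdivlMr ?ltr0n// mul1r.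
have /andP[e2 _] := @expR1_bounds R.
by apply: (@le_trans _ _ n%:R); rewrite ?ler_nat// ler_peMl ?ler0n//; lra.
Qed.

(** * The quantile bound *)

(** The plus signs contribute factors [1 - q <= 1], so dropping them gives p_v(e) <= q^N with N the
    number of minus signs. *)
Lemma Gamma_ge_count {R : realType} {n k : nat} (t : n.-tuple R)
    (e : n.-tuple bool) (q : R) :
  0 < q < 1 -> uniq t -> ((count id e).*2 < k)%N ->
  (count id e)%:R * ln (1 / q) <= Gamma (vandermonde k t) e (logit (1 - q) *: ones).
Proof.
move=> /[dup] q01 /andP[q0 q1] ut ek; apply: le_trans (Gamma_ge_separated t e _ ut ek).
rewrite mulr_natl -lnXn ?divr_gt0// ler_ln ?posrE ?exprn_gt0 ?divr_gt0 ?pmf_sign_gt0//.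
rewrite pmf_sign_count// expr_div_n expr1n ler_pM2l// lef_pV2 ?posrE ?mulr_gt0 ?exprn_gt0 ?subr_gt0//.
by rewrite ler_piMr ?exprn_ile1 ?exprn_ge0//; lra.
Qed.

Lemma binomial_half_concentration {R : realType} (n m : nat) :
  (16 <= m <= n)%N ->
  1 / 2 <= bin_mean (m%:R / (2 * n%:R) : R) n
     (fun j => ((m <= 4 * j) && (4 * j <= 3 * m))%N%:R).
Proof.
move=> /andP[m16 mn]; have n0 : 0 < n%:R :> R by rewrite ltr0n; lia.
have m16' : 16 <= m%:R :> R by rewrite ler_nat.
have mn' : m%:R <= n%:R :> R by rewrite ler_nat.
set q := m%:R / (2 * n%:R).
have nq : n%:R * q = m%:R / 2 by rewrite /q; field; lra.
have q01 : 0 < q < 1.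
  by rewrite /q divr_gt0 ?mulr_gt0//=; [rewrite ltr_pdivrMr ?mulr_gt0//; lra|lra].
(* Chebyshev: [c] is (m/4)^-2, so 1 - c (j - m/2)^2 lies below the indicator of the window. The
   variance is at most m/2, which makes the loss at most 8/m <= 1/2. *)
pose c : R := 16 / m%:R ^+ 2.
have := bin_mean_quartic q n 0 0 (- c) 0 1; rewrite /= nq => E.
apply: (@le_trans _ _ (bin_mean q n (fun j => let x := j%:R - m%:R / 2 in
    0 * x ^+ 4 + 0 * x ^+ 3 + - c * x ^+ 2 + 0 * x + 1))).
  rewrite E !mul0r !add0r mulNr.
  have : c * (m%:R / 2 * (1 - q)) <= 1 / 2.
    apply: (@le_trans _ _ (c * (m%:R / 2))).
      by rewrite ler_wpM2l ?ler_piMr//; rewrite /c ?divr_ge0//; lra.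
    rewrite (_ : c * _ = 8 / m%:R); last by rewrite /c; field; lra.
    by rewrite ler_pdivrMr; lra.
  by lra.
apply: le_bin_mean => // j /=; rewrite !mul0r !add0r addr0 mulNr.
have c0 : 0 < c by rewrite /c divr_gt0 ?exprn_gt0//; lra.
case: (boolP ((m <= 4 * j) && (4 * j <= 3 * m))%N) => [_|].
  by rewrite addrC lerBlDr lerDl mulr_ge0 ?sqr_ge0// ltW.
rewrite negb_and -!ltnNge -!(ltr_nat R) !natrM => far.
suff : 1 <= c * (j%:R - m%:R / 2) ^+ 2 by rewrite /=; lra.
have m0 : 0 < m%:R ^+ 2 :> R by rewrite exprn_gt0//; lra.
rewrite /c mulrAC ler_pdivlMr// mul1r.
by case/orP: far => far; nra.
Qed.

(** The probability is (1 - 1/n)^(n-1), the inverse of (1 + 1/(n-1))^(n-1) < e. Strictness matters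
    because [delta] may equal 1/e. *)
Lemma binomial_single {R : realType} (n : nat) : (1 < n)%N ->
  (expR 1)^-1 < bin_mean (1 / n%:R : R) n (fun j => (j == 1)%:R).
Proof.
case: n => // n n0; have n0' : 0 < n%:R :> R by rewrite ltr0n.
rewrite (eq_bin_mean _ _ _ (fun j => 1 * (j == 1)%:R)) => [|j]; last by rewrite mul1r.
rewrite bin_mean_eq1 mul1r -natr1.
rewrite (_ : _ * (1 / _) = 1) ?mul1r; last by field; lra.
rewrite (_ : 1 - _ = (1 + n%:R^-1)^-1); last by field; lra.
have i0 : 0 < n%:R^-1 :> R by rewrite invr_gt0.
rewrite exprVn ltf_pV2 ?posrE ?exprn_gt0 ?expR_gt0 ?addr_gt0//.
rewrite -[in ltRHS](divff (lt0r_neq0 n0')) expRM_natl ltrXn2r ?nnegrE ?expR_ge0//.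
- by rewrite -lt0n.
- by rewrite expR_gt1Dx// gt_eqF.
Qed.

(** [B] collects the favourable numbers of minus signs. For m >= 16, m <= 4j turns 4m into 16j; for
    m <= 15, k <= 2m + 2 <= 32 while j = 1 and en/k <= n. Hence the factor 32. *)
Lemma quantile_core_log {R : realType} (n k : nat) : (3 <= k <= n)%N ->
  exists (q : R) (B : pred nat), [/\ 0 < q < 1,
    (expR 1)^-1 < bin_mean q n (fun j => (B j)%:R) &
    forall j, B j -> (j.*2 < k)%N /\
      k%:R * ln (expR 1 * n%:R / k%:R) <= 32 * (j%:R * ln (1 / q))].
Proof.
move=> /andP[k3 kn]; have [m0 mk km] := half_degree_bounds k k3.
move: (k.-1 %/ 2)%N m0 mk km => m m0 mk km.
have /andP[e2 e3] := @expR1_bounds R.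
have n0 : 0 < n%:R :> R by rewrite ltr0n; lia.
have k0 : 0 < k%:R :> R by rewrite ltr0n; lia.
have m0' : 0 < m%:R :> R by rewrite ltr0n.
have mk' : 2 * m%:R < k%:R :> R by rewrite -natrM ltr_nat; lia.
have kn' : k%:R <= n%:R :> R by rewrite ler_nat.
have k3' : 3 <= k%:R :> R by rewrite ler_nat.
have [m16|m16] := leqP 16 m.
  exists (m%:R / (2 * n%:R)), (fun j => (m <= 4 * j) && (4 * j <= 3 * m))%N; split.
  - by rewrite divr_gt0 ?mulr_gt0//= ltr_pdivrMr ?mulr_gt0//; lra.
  - apply: (@lt_le_trans _ _ (1 / 2)).
      by rewrite div1r ltf_pV2 ?posrE//; lra.
    by apply: binomial_half_concentration; lia.
  move=> j /andP[j1 j2]; split; first by lia.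
  rewrite div1r invf_div; set X := _ / m%:R.
  have X1 : 1 <= X by rewrite /X ler_pdivlMr//; lra.
  have := ln_ge0 X1; set l := ln X => l0.
  apply: (@le_trans _ _ (4 * m%:R * l)).
    apply: k_log_le => //; first by lia.
    rewrite /X ler_pdivrMr// mulrAC ler_pdivlMr//.
    by have := mulr_gt0 n0 m0'; nra.
  have : m%:R <= 4 * j%:R :> R by rewrite -natrM ler_nat.
  by nra.
exists (1 / n%:R), (fun j => j == 1%N); split.
- by rewrite divr_gt0//= ltr_pdivrMr//; lra.
- by apply: binomial_single; lia.
move=> j /eqP ->; split; first by lia.
rewrite div1r invf_div divr1 mul1r.
apply: (ler_pM (ltW k0)); rewrite ?ler_nat//; last 2 first.
- by lia.
- rewrite ler_ln ?posrE// ?divr_gt0 ?mulr_gt0 ?expR_gt0//.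
  by rewrite ler_pdivrMr//; nra.
by have := @k_log_ge0 R n k; rewrite pmulr_rge0//; apply; lia.
Qed.

(** The larger of the two terms is at least half their sum, so each case treats one term only; 64 is
    twice 32. *)
Lemma quantile_core {R : realType} (n k : nat) (delta : R) :
  (3 <= k <= n)%N -> 0 < delta <= (expR 1)^-1 ->
  exists (q : R) (b : pred (n.-tuple bool)), let v := logit (1 - q) *: ones in
    delta < \sum_e pmf_sign v e * (b e)%:R /\
    forall (t : n.-tuple R) e, uniq t -> b e ->
      1 / 64 * (k%:R * ln (expR 1 * n%:R / k%:R) + ln (1 / delta)) <=
      Gamma (vandermonde k t) e v.
Proof.
move=> k3n /andP[d0 de].
have [small|large] := leP (ln (1 / delta)) (k%:R * ln (expR 1 * n%:R / k%:R)).
  have [q [B [q01 BS BL]]] := @quantile_core_log R n k k3n.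
  exists q, (fun e => B (count id e)) => /=; split.
    rewrite (mean_sign_count q (fun j => (B j)%:R) q01).
    exact: le_lt_trans de BS.
  move=> t e ut /BL[ek L_le]; apply: le_trans _ (Gamma_ge_count t e q q01 ut ek).
  by lra.
have n0 : 0 < n%:R :> R by rewrite ltr0n; lia.
have e2 : 1 < expR 1 :> R by have /andP[] := @expR1_bounds R; lra.
have d1 : delta < 1 by apply: le_lt_trans de _; rewrite invf_lt1//; lra.
have ld : ln (1 / delta) = - ln delta by rewrite ln_div ?posrE// ln1 sub0r.
have ld0 : ln delta < 0 by rewrite ln_lt0// d0 d1.
(* [expR x] is the probability of a plus sign; its n-th power is the square root of [delta], which
   exceeds [delta]. *)
pose x := ln delta / (2 * n%:R).
have x0 : x < 0 by rewrite /x ltr_pdivrMr ?mulr_gt0// mul0r.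
have q01 : 0 < 1 - expR x < 1.
  have : expR x < expR 0 by rewrite ltr_expR.
  by rewrite expR0; have := expR_gt0 x; lra.
have xn : n%:R * x = ln delta / 2 by rewrite /x; field; lra.
have half_lt : ((0%N).*2 < k)%N by lia.
exists (1 - expR x), (fun e => count id e == 0%N) => /=; split.
  rewrite (mean_sign_count (1 - expR x) (fun j => (j == 0%N)%:R) q01).
  rewrite (eq_bin_mean _ _ _ (fun j => 1 * (j == 0)%:R)) => [|j]; last by rewrite mul1r.
  rewrite bin_mean_eq0 mul1r subKr -expRM_natl xn -[ltLHS]lnK ?posrE// ltr_expR.
  by lra.
move=> t e ut /eqP ce; have ek : ((count id e).*2 < k)%N by rewrite ce.
apply: le_trans (Gamma_ge_separated t e _ ut ek).
rewrite pmf_sign_count// ce subn0 expr0 !mul1r subKr -expRM_natl xn.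
rewrite !lnV ?posrE ?expR_gt0// expRK.
by lra.
Qed.

(** * The expectation bound *)

(** [h] is a minorant of [Gamma] in terms of the count: separation covers few minus signs,
    nonnegativity of [Gamma] covers the rest. It may be negative, which admits a polynomial test
    function. *)
Lemma mean_Gamma_ge {R : realType} {n k : nat} (t : n.-tuple R) (q : R)
    (h : nat -> R) :
  (0 < k)%N -> 0 < q < 1 -> uniq t ->
  (forall j, (j.*2 < k)%N -> h j <= j%:R * ln (1 / q)) ->
  (forall j, (k <= j.*2)%N -> h j <= 0) ->
  let v := logit (1 - q) *: ones in
  bin_mean q n h <= \sum_e pmf_sign v e * Gamma (vandermonde k t) e v.
Proof.
move=> k0 q01 ut hsmall hlarge /=; rewrite -(mean_sign_count q h q01).
apply: ler_sum => e _; apply: ler_wpM2l; first by rewrite ltW// pmf_sign_gt0.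
have [ek|ek] := ltnP (count id e).*2 k.
  by apply: le_trans (hsmall _ ek) _; exact: Gamma_ge_count.
by apply: le_trans (hlarge _ ek) _; exact: Gamma_const_ge0.
Qed.

(* [f] is bounded above and positive only on [-4, 0], while [E f(Y) > 0] when
   [E Y = 0], [E Y^2 = 1] and [E Y^4 < 8]; hence [P(-4 <= Y <= 0)] is bounded
   away from 0. *)
Lemma quartic_test {R : realType} (y : R) :
  let f := - (3 / 2) * y + y ^+ 2 - y ^+ 4 / 8 in
  (0 <= y -> f <= 0) /\ (y <= -4 -> f <= 0) /\ (-4 <= y <= 0 -> f <= 22).
Proof.
have fE : - (3 / 2) * y + y ^+ 2 - y ^+ 4 / 8 = y * (- (3 / 2) + y - y ^+ 3 / 8).
  by field.
split=> [y0|]; last split=> [y4|/andP[y4 y0]].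
- rewrite /= fE mulr_ge0_le0//.
  have : 0 <= (y - 2) ^+ 2 * (y + 4) by rewrite mulr_ge0 ?sqr_ge0//; lra.
  have : 0 <= y ^+ 3 by rewrite exprn_ge0.
  by rewrite !exprS expr0; lra.
- rewrite /= fE mulr_le0_ge0//; first by lra.
  have : 0 <= (- 4 - y) * (y ^+ 2 - 4 * y + 8) by rewrite mulr_ge0//; nra.
  by rewrite !exprS expr0; lra.
- have y2 : y ^+ 2 <= 16 by nra.
  have : 0 <= y ^+ 4 by rewrite exprn_even_ge0.
  by rewrite /=; lra.
Qed.

Lemma mean_core_large {R : realType} (n k : nat) (t : n.-tuple R) :
  let m := (k.-1 %/ 2)%N in let q := m%:R / n%:R : R in
  let v := logit (1 - q) *: ones in
  (3 <= k <= n)%N -> (64 <= m)%N -> uniq t ->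
  m%:R * ln (n%:R / m%:R) <=
    88 * \sum_e pmf_sign v e * Gamma (vandermonde k t) e v.
Proof.
move=> m q v /andP[k3 kn] m64 ut; have [m0 mk km] := half_degree_bounds k k3.
rewrite -/m in m0 mk km; clearbody m.
have k0 : (0 < k)%N by lia.
have le_m j : (j.*2 < k)%N -> j%:R <= m%:R :> R by rewrite ler_nat; lia.
have ge_m j : (k <= j.*2)%N -> m%:R <= j%:R :> R by rewrite ler_nat; lia.
have n0 : 0 < n%:R :> R by rewrite ltr0n; lia.
have m64' : 64 <= m%:R :> R by rewrite ler_nat.
have mn : 2 * m%:R < n%:R :> R by rewrite -natrM ltr_nat; lia.
have q01 : 0 < q < 1 / 2.
  by rewrite /q divr_gt0//=; [rewrite ltr_pdivrMr//; lra|lra].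
have nq : n%:R * q = m%:R by rewrite /q; field; lra.
set l := ln (n%:R / m%:R).
have l0 : 0 <= l by rewrite ln_ge0// ler_pdivlMr//; lra.
have l_q : ln (1 / q) = l by rewrite div1r invf_div.
pose s := m%:R * (1 - q).
have s_bounds : m%:R / 2 <= s <= m%:R by rewrite /s; apply/andP; split; nra.
pose r := Num.sqrt s.
have r0 : 0 < r by rewrite sqrtr_gt0; lra.
have rs : r ^+ 2 = s by rewrite sqr_sqrtr//; lra.
(* From r^2 <= m and m >= 64. Thus y >= -4 gives j >= m - 4r >= m/2. *)
have rm : r <= m%:R / 8 by nra.
(* Since [f <= 22] on [-4, 0], this scaling keeps [h j] below m/2 * l <= j * l there. It also yields
   the constant 88, as K / 2 = m * l / 88. *)
pose K := m%:R / 2 * l / 22.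
have K0 : 0 <= K by rewrite /K !mulr_ge0//; lra.
pose f (y : R) := - (3 / 2) * y + y ^+ 2 - y ^+ 4 / 8.
pose h j := K * f ((j%:R - m%:R) / r).
have hb : bin_mean q n h <= \sum_e pmf_sign v e * Gamma (vandermonde k t) e v.
  apply: (@mean_Gamma_ge R n k t q h k0 _ ut); first by lra.
    move=> j /le_m jm.
    rewrite l_q /h; set y := _ / r.
    have yr : y * r = j%:R - m%:R by rewrite /y; field; lra.
    have y0 : y <= 0 by rewrite /y ler_pdivrMr//; lra.
    have [_ [flow fmid]] := quartic_test y; rewrite -/(f y) in flow fmid.
    have jl : 0 <= j%:R * l by rewrite mulr_ge0.
    have [y4|y4] := leP y (-4); first by have := flow y4; nra.
    have f22 : f y <= 22 by apply: fmid; lra.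
    have jm2 : m%:R / 2 <= j%:R :> R by nra.
    apply: (@le_trans _ _ (K * 22)); first exact: ler_wpM2l.
    by rewrite /K; nra.
  move=> j /ge_m jm; have [f0 _] := quartic_test ((j%:R - m%:R) / r).
  apply: mulr_ge0_le0 => //; apply: f0.
  by rewrite divr_ge0//; lra.
suff : K / 2 <= bin_mean q n h by rewrite /K in hb *; lra.
have := bin_mean_quartic q n (- K / (8 * r ^+ 4)) 0 (K / r ^+ 2) (- (3 / 2) * K / r) 0.
rewrite /= nq -/s => E.
rewrite (eq_bin_mean _ _ h (fun j => let x := j%:R - m%:R in
   - K / (8 * r ^+ 4) * x ^+ 4 + 0 * x ^+ 3 + K / r ^+ 2 * x ^+ 2
   + - (3 / 2) * K / r * x + 0)); last first.
  by move=> j; rewrite /h /f; field; lra.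
rewrite /= E mul0r !addr0 (_ : r ^+ 4 = s ^+ 2); last by rewrite -rs -exprM.
rewrite rs divfK; last by lra.
rewrite [X in _ <= X + _](_ : _ = - K * ((3 + (1 - 6 * q * (1 - q)) / s) / 8)); last by field; lra.
(* The standardised fourth moment is thus at most 4, and the mean of [h] at least K (1 - 4/8). *)
have : (1 - 6 * q * (1 - q)) / s <= 1 by rewrite ler_pdivrMr; nra.
by nra.
Qed.

(** A single minus sign has probability m (1 - q)^(n-1) >= m exp(-2m) and contributes at least
    [l]. *)
Lemma mean_core_small {R : realType} (n k : nat) (t : n.-tuple R) :
  let m := (k.-1 %/ 2)%N in let q := m%:R / n%:R : R in
  let v := logit (1 - q) *: ones in
  (3 <= k <= n)%N -> uniq t ->
  m%:R * ln (n%:R / m%:R) <=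
    expR (2 * m%:R) * \sum_e pmf_sign v e * Gamma (vandermonde k t) e v.
Proof.
move=> m q v /andP[k3 kn] ut; have [m0 mk km] := half_degree_bounds k k3.
rewrite -/m in m0 mk km; clearbody m.
have n0 : 0 < n%:R :> R by rewrite ltr0n; lia.
have m0' : 0 < m%:R :> R by rewrite ltr0n.
have mn : 2 * m%:R < n%:R :> R by rewrite -natrM ltr_nat; lia.
have q01 : 0 < q < 1 / 2.
  by rewrite /q divr_gt0//= ltr_pdivrMr//; lra.
have nq : n%:R * q = m%:R by rewrite /q; field; lra.
set l := ln (n%:R / m%:R).
have l0 : 0 <= l by rewrite ln_ge0// ler_pdivlMr//; lra.
have l_q : ln (1 / q) = l by rewrite div1r invf_div.
have hb : bin_mean q n (fun j => l * (j == 1)%:R) <=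
    \sum_e pmf_sign v e * Gamma (vandermonde k t) e v.
  apply: (@mean_Gamma_ge R n k t q) ut _ _; [lia|lra| |] => j jk; rewrite ?l_q.
    by case: (eqVneq j 1%N) => [->|_]; rewrite ?mulr1 ?mul1r// mulr0 mulr_ge0.
  by rewrite (_ : (j == 1)%N = false) ?mulr0//; lia.
rewrite -ler_pdivrMl ?expR_gt0//; apply: le_trans hb.
have {1}-> : n = n.-1.+1 by lia.
rewrite bin_mean_eq1 (_ : n.-1.+1%:R = n%:R :> R); last by congr (_%:R); lia.
rewrite nq mulrA [l * _]mulrC [leLHS]mulrC ler_wpM2l ?mulr_ge0// ?(ltW m0')//.
(* For q < 1/2, 1 / (1 - q) <= 1 + 2q <= exp(2q). *)
have e1q : expR (- (2 * q)) <= 1 - q.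
  rewrite expRN -[leRHS]invrK lef_pV2 ?posrE ?expR_gt0 ?invr_gt0; try by lra.
  apply: le_trans (expR_ge1Dx _); rewrite invf_ple ?posrE; try by lra.
  by rewrite -[leLHS]div1r ler_pdivrMr; nra.
apply: (@le_trans _ _ ((1 - q) ^+ n)).
  rewrite -expRN -nq (_ : - _ = n%:R * (- (2 * q))); last by ring.
  by rewrite expRM_natl lerXn2r ?nnegrE ?expR_ge0//; lra.
by rewrite ler_wiXn2l ?leq_pred//; lra.
Qed.

Lemma mean_core {R : realType} : exists2 c : R, 0 < c <= 1 / 64 &
  forall (n k : nat) (t : n.-tuple R), (3 <= k <= n)%N -> uniq t ->
  let v := logit (1 - (k.-1 %/ 2)%:R / n%:R) *: ones in
  c * (k%:R * ln (expR 1 * n%:R / k%:R)) <=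
    \sum_e pmf_sign v e * Gamma (vandermonde k t) e v.
Proof.
have E0 := expR_gt0 (-128 : R).
have E1 : expR (-128) <= 1 :> R.
  by have : expR (-128) <= expR 0 :> R; [rewrite ler_expR; lra|rewrite expR0].
have Em m : (m < 64)%N -> expR (-128) <= (expR (2 * m%:R))^-1 :> R.
  by rewrite -(ltr_nat R) => m64; rewrite -expRN ler_expR; lra.
move: (expR (-128)) E0 E1 Em => E E0 E1 Em.
(* 704 is 8 * 88, from [L_le] and the case m >= 64; [E] bounds exp(-2m) from below for m < 64. *)
exists (E / 704); first by lra.
move=> n k t k3n ut; have small := mean_core_small n k t k3n ut.
have large := mean_core_large n k t k3n ^~ ut; move: small large; rewrite /=.
move: (\sum_e _) => S; case/andP: k3n => k3 kn.
have [m0 mk km] := half_degree_bounds k k3; rewrite /= in m0 mk km.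
move: (k.-1 %/ 2)%N m0 mk km => m m0 mk km small large.
have k0n : (0 < k <= n)%N by lia.
have k4m : (0 < k <= 4 * m)%N by lia.
have n0 : 0 < n%:R :> R by rewrite ltr0n; lia.
have m0' : 0 < m%:R :> R by rewrite ltr0n.
have mn : 2 * m%:R < n%:R :> R by rewrite -natrM ltr_nat; lia.
have mk2 : 2 * m%:R < k%:R :> R by rewrite -natrM ltr_nat; lia.
have /andP[e2 e3] := @expR1_bounds R.
have X2 : 2 <= n%:R / m%:R :> R by rewrite ler_pdivlMr//; lra.
have L_le : k%:R * ln (expR 1 * n%:R / k%:R) <= 8 * (m%:R * ln (n%:R / m%:R)) :> R.
  have X0 : 0 < n%:R / m%:R :> R by lra.
  (* As n/m >= 2, en/k <= 2n/m <= (n/m)^2; the square absorbs the constant and doubles the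
     logarithm. *)
  apply: (@le_trans _ _ (4 * m%:R * ln ((n%:R / m%:R) ^+ 2))).
    apply: (k_log_le n k m _ k4m kn); first by nra.
    apply: (@le_trans _ _ (2 * (n%:R / m%:R))); last by nra.
    rewrite ler_pdivrMr; last by lra.
    rewrite (_ : 2 * _ * _ = 2 * n%:R * k%:R / m%:R); last by field; lra.
    by rewrite ler_pdivlMr//; have := mulr_gt0 n0 m0'; nra.
  by rewrite lnXn// mulr2n; lra.
have l0 : 0 <= m%:R * ln (n%:R / m%:R) :> R.
  by rewrite mulr_ge0 ?ln_ge0//; lra.
have [m64|m64] := leqP 64 m.
  have L0 : 0 <= k%:R * ln (expR 1 * n%:R / k%:R) :> R by exact: k_log_ge0.
  have {}large := large m64.
  have : E * (k%:R * ln (expR 1 * n%:R / k%:R)) <=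
      8 * (m%:R * ln (n%:R / m%:R)) by nra.
  by lra.
have S_le : E * (m%:R * ln (n%:R / m%:R)) <= S.
  apply: (@le_trans _ _ ((expR (2 * m%:R))^-1 * (m%:R * ln (n%:R / m%:R)))).
    by rewrite ler_wpM2r//; exact: Em.
  by rewrite ler_pdivrMl ?expR_gt0.
have : E * (k%:R * ln (expR 1 * n%:R / k%:R)) <=
  E * (8 * (m%:R * ln (n%:R / m%:R))) by rewrite ler_wpM2l// ltW.
by have := mulr_ge0 (ltW E0) l0; lra.
Qed.

Theorem proposition2p4 (R : realType) :
  exists2 c : R, 0 < c &
  forall (n k : nat) (delta : R), (3 <= k <= n)%N -> 0 < delta <= (expR 1)^-1 ->
  [/\ (* fixed design *)
      ((c * (k%:R * ln (expR 1 * n%:R / k%:R) + ln (1 / delta)))%:E <=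
       ereal_sup [set ereal_inf [set
           quantile (sign_prob (lambda *: ones)) (1 - delta)
             (fun e => Gamma (vandermonde k t) e (lambda *: ones))
         | t in @fixed_design R n] | lambda in [set: R]])%E,
      (* random design *)
      forall P : probability (measurableTypeR R) R,
        P `[0, 1]%classic = 1%E ->
        {ae iid_law P n, forall t : n.-tuple (measurableTypeR R), uniq (t : seq R)} ->
        ((c * (k%:R * ln (expR 1 * n%:R / k%:R) + ln (1 / delta)))%:E <=
         ereal_sup [set
           quantile (iid_law P n \x sign_prob (lambda *: ones))%E (1 - delta)
             (fun te => Gamma (vandermonde k te.1) te.2 (lambda *: ones))
         | lambda in [set: R]])%E
    & (* expectation *)
      forall P : probability (measurableTypeR R) R,
        P `[0, 1]%classic = 1%E ->
        {ae iid_law P n, forall t : n.-tuple (measurableTypeR R), uniq (t : seq R)} ->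
        ((ereal_inf [set
            'E_(sign_prob (vnk n k))[fun e => Gamma (vandermonde k t) e (vnk n k)]
          | t in @fixed_design R n]
          <= \int[iid_law P n]_t
            'E_(sign_prob (vnk n k))[fun e => Gamma (vandermonde k t) e (vnk n k)])%E
        /\
        ((c * (k%:R * ln (expR 1 * n%:R / k%:R)))%:E <=
          ereal_inf [set
            'E_(sign_prob (vnk n k))[fun e => Gamma (vandermonde k t) e (vnk n k)]
          | t in @fixed_design R n])%E)].
Proof.
have [c /andP[c0 c64] c_mean] := @mean_core R.
exists c => // n k delta k3n d01.
have k0 : (0 < k)%N by lia.
have n0 : 0 < n%:R :> R by rewrite ltr0n; lia.
(* [q] and [b] are fixed before any design is given, so one [lambda] serves all designs, fixed or
   random. *)
have [q [b [db bG]]] := quantile_core n k delta k3n d01.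
set L := k%:R * _ in bG *; set v := logit (1 - q) *: ones in db bG.
have c_le : c * (L + ln (1 / delta)) <= 1 / 64 * (L + ln (1 / delta)).
  have L0 : 0 <= L by apply: k_log_ge0; lia.
  have : 0 <= ln (1 / delta).
    move: d01 => /andP[d0 de]; rewrite ln_ge0// ler_pdivlMr// mul1r.
    apply: le_trans de _; have /andP[e2 _] := @expR1_bounds R.
    by rewrite invf_le1//; lra.
  by nra.
have q01 : 0 < ((k.-1 %/ 2)%:R / n%:R : R) < 1.
  by rewrite divr_gt0 ?ltr0n//= ?ltr_pdivrMr ?mul1r ?ltr_nat//; lia.
split.
- apply: (@le_trans _ _ (1 / 64 * (L + ln (1 / delta)))%:E); first by rewrite lee_fin.
  apply: le_ereal_sup_tmp; eexists; first by exists (logit (1 - q)).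
  apply: le_ereal_inf_tmp => _ [t /fixed_design_uniq ut <-].
  by apply: (quantile_sign_ge _ b) => // e; exact: bG.
- move=> P P01 aeu.
  apply: (@le_trans _ _ (1 / 64 * (L + ln (1 / delta)))%:E); first by rewrite lee_fin.
  apply: le_ereal_sup_tmp; eexists; first by exists (logit (1 - q)).
  by apply: (quantile_random_ge _ _ _ b _ _ _ aeu) => // t e; exact: bG.
- move=> P P01 aeu; split; first exact: inf_fixed_le_random.
  apply: le_ereal_inf_tmp => _ [t /fixed_design_uniq ut <-].
  rewrite expectation_Gamma// lee_fin; exact: c_mean.
Qed.
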